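(* Let $A$ be a ring, let $A\to B$ and $A\to R$ be $A$-algebras, and let $m\in\mathbb N\cup\{\infty\}$. There is a natural bijection $$\operatorname{Hom}_A(\mathrm{HS}^m_{B/A},R) \to \begin{cases} \operatorname{Hom}_A(B,R[t]/(t^{m+1})), & m<\infty;\\ \operatorname{Hom}_A(B,R[[t]]), & m=\infty,\end{cases}$$ in which a map $\phi\in\operatorname{Hom}_A(\mathrm{HS}^m_{B/A},R)$ is associated to the map $B\to R[t]/(t^{m+1})$ (resp. $B\to R[[t]]$) given by $$x\mapsto \phi(d_0x)+\phi(d_1x)t+\dots+\phi(d_mx)t^m \pmod{(t^{m+1})}$$ (for $m=\infty$, the power series $\sum_{i\ge0}\phi(d_ix)t^i$). This bijection is obtained from the bijection $\operatorname{Hom}_A(\mathrm{HS}^m_{B/A},R)\to\operatorname{Der}^m_A(B,R)$, $\phi\mapsto(\phi\circ d_0,\dots,\phi\circ d_m)$, followed by the bijection sending $(D_0,\dots,D_m)\in\operatorname{Der}^m_A(B,R)$ to the map $x\mapsto D_0(x)+D_1(x)t+\dots+D_m(x)t^m$.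
   Context: All rings and algebras are commutative with $1$; $\mathbb N$ contains $0$; when $m=\infty$, ''$i=1,\dots,m$'' means all positive integers $i$ (and ''$i=0,\dots,m$'' all $i\ge 0$), and $(D_0,\dots,D_m)$ means $(D_0,D_1,\dots)$. $\operatorname{Hom}_A$ denotes $A$-algebra homomorphisms. For a ring homomorphism $f\colon A\to B$, $\mathrm{HS}^m_{B/A}$ is the quotient of the polynomial algebra $B[x^{(i)}]_{x\in B,\ i=1,\dots,m}$ by the ideal generated by: $(x+y)^{(i)}-x^{(i)}-y^{(i)}$ for $x,y\in B$, $i=1,\dots,m$; $f(a)^{(i)}$ for $a\in A$, $i=1,\dots,m$; and $(xy)^{(k)}-\sum_{i+j=k}x^{(i)}y^{(j)}$ for $x,y\in B$, $k=0,\dots,m$, where $x^{(0)}$ is identified with $x$. Write $d_i x$ for the class of $x^{(i)}$ (so $d_0x=x$). A higher derivation of order $m$ from $B$ to $R$ over $A$ is a sequence $(D_0,\dots,D_m)$ where $D_0\colon B\to R$ is an $A$-algebra homomorphism and $D_1,\dots,D_m\colon B\to R$ are homomorphisms of additive groups with $D_i(f(a))=0$ for all $a\in A$ and $i=1,\dots,m$, and $D_k(xy)=\sum_{i+j=k}D_i(x)D_j(y)$ for all $x,y\in B$, $k=0,\dots,m$. $\operatorname{Der}^m_A(B,R)$ is the set of these. *)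

(* Defs.v *)
From HB Require Import structures.
From mathcomp Require Import all_boot all_algebra ring_quotient finmap.
From mathcomp Require Import boolp.
From mathcomp Require Import monalg.

Set Implicit Arguments.
Unset Strict Implicit.
Unset Printing Implicit Defensive.

Import GRing.Theory.
Local Open Scope ring_scope.

(* Rings may be zero (comPzRingType).  Since {poly R} and the ring structure
   on {malg R[K]} require 1 != 0, the polynomial algebra R[x_i]_{i in I} is
   {malg R[{cmonom I}]} with its product re-established for zero rings. *)
Definition mvpoly (R : comPzRingType) (I : choiceType) : Type :=
  {malg R[{cmonom I}]}.

HB.instance Definition _ R I := GRing.Zmodule.on (mvpoly R I).

HB.lock Definition mvpoly_one (R : comPzRingType) (I : choiceType) :
  mvpoly R I := mkmalgU (mone : {cmonom I}) 1.

HB.lock Definition mvpoly_mul (R : comPzRingType) (I : choiceType)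
    (p q : mvpoly R I) : mvpoly R I :=
  \sum_(k1 <- msupp p) \sum_(k2 <- msupp q)
     mkmalgU (mmul k1 k2) (mcoeff k1 p * mcoeff k2 q).

HB.lock Definition mvpolyC (R : comPzRingType) (I : choiceType) (a : R) :
  mvpoly R I := mkmalgU mone a.

HB.lock Definition mvpolyX (R : comPzRingType) (I : choiceType) (i : I) :
  mvpoly R I := mkmalgU (ucm i) 1.

Section MvPoly.
Variables (R : comPzRingType) (I : choiceType).
Implicit Types p q r : mvpoly R I.

Local Notation mvpolyC := (@mvpolyC R I).
Local Notation mvpoly_one := (mvpoly_one R I).
Local Notation mvpoly_mul := (@mvpoly_mul R I).

Section NonZero.
Hypothesis nz : 1 != 0 :> R.
Let Rnz : comNzRingType :=
  HB.pack (GRing.ComPzRing.sort R) (GRing.PzSemiRing_isNonZero.Build R nz).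

Let mulE : mvpoly_mul = @GRing.mul {malg Rnz[{cmonom I}]}.
Proof. by rewrite mvpoly_mul.unlock. Qed.
Let oneE : mvpoly_one = (1 : {malg Rnz[{cmonom I}]}).
Proof. by rewrite mvpoly_one.unlock. Qed.

Let mulA : associative mvpoly_mul.
Proof. rewrite mulE; exact: (@mulrA {malg Rnz[{cmonom I}]}). Qed.
Let mulC : commutative mvpoly_mul.
Proof. rewrite mulE; exact: (@mulrC {malg Rnz[{cmonom I}]}). Qed.
Let mul1 : left_id mvpoly_one mvpoly_mul.
Proof. rewrite mulE oneE; exact: (@mul1r {malg Rnz[{cmonom I}]}). Qed.
Let mulD : left_distributive mvpoly_mul +%R.
Proof. rewrite mulE; exact: (@mulrDl {malg Rnz[{cmonom I}]}). Qed.
Let CM (a b : R) : mkmalgU (mone : {cmonom I}) (a * b) =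
  mvpoly_mul (mkmalgU mone a) (mkmalgU mone b).
Proof. rewrite mulE; exact: (@mpolyCM {cmonom I} Rnz). Qed.

Lemma mvpoly_axioms_nz : [/\ associative mvpoly_mul, commutative mvpoly_mul,
  left_id mvpoly_one mvpoly_mul, left_distributive mvpoly_mul +%R &
  forall a b : R, mkmalgU (mone : {cmonom I}) (a * b) =
    mvpoly_mul (mkmalgU mone a) (mkmalgU mone b)].
Proof. by split. Qed.
End NonZero.

Lemma mvpoly_axioms : [/\ associative mvpoly_mul, commutative mvpoly_mul,
  left_id mvpoly_one mvpoly_mul, left_distributive mvpoly_mul +%R &
  forall a b : R, mkmalgU (mone : {cmonom I}) (a * b) =
    mvpoly_mul (mkmalgU mone a) (mkmalgU mone b)].
Proof.
have [R0|] := eqVneq (1 : R) 0; last exact: mvpoly_axioms_nz.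
have eqR (a b : R) : a = b by rewrite -[a]mulr1 -[b]mulr1 R0 !mulr0.
have eqP (p q : mvpoly R I) : p = q by apply/malgP => k; apply: eqR.
by split; repeat move=> ?; apply: eqP.
Qed.

Let mulA : associative mvpoly_mul. Proof. by case: mvpoly_axioms. Qed.
Let mulC : commutative mvpoly_mul. Proof. by case: mvpoly_axioms. Qed.
Let mul1 : left_id mvpoly_one mvpoly_mul. Proof. by case: mvpoly_axioms. Qed.
Let mulD : left_distributive mvpoly_mul +%R. Proof. by case: mvpoly_axioms. Qed.

HB.instance Definition _ :=
  GRing.Zmodule_isComPzRing.Build (mvpoly R I) mulA mulC mul1 mulD.

Lemma mvpoly1E : mvpoly_one = 1. Proof. by []. Qed.
Lemma mvpolyC_zmod : zmod_morphism mvpolyC.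
Proof. by rewrite mvpolyC.unlock; exact: monalgUB. Qed.
Lemma mvpolyC_monoid : monoid_morphism mvpolyC.
Proof.
rewrite mvpolyC.unlock; split=> [|a b]; last by case: mvpoly_axioms.
by rewrite -mvpoly1E mvpoly_one.unlock.
Qed.

HB.instance Definition _ :=
  GRing.isZmodMorphism.Build R (mvpoly R I) mvpolyC mvpolyC_zmod.
HB.instance Definition _ :=
  GRing.isMonoidMorphism.Build R (mvpoly R I) mvpolyC mvpolyC_monoid.
End MvPoly.

Arguments mvpolyC {R} I a.
Arguments mvpolyX R {I} i.

Section IdealQuotient.
Variable (P : comPzRingType).

Definition in_ideal (G : P -> Prop) (x : P) : Prop :=
  exists s : seq (P * P),
    (forall u, u \in s -> G u.2) /\ x = \sum_(u <- s) u.1 * u.2.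

Definition ideal_of (G : P -> Prop) (x : P) : bool := `[< in_ideal G x >].

Variable (G : P -> Prop).

Lemma ideal_ofP x : reflect (in_ideal G x) (x \in ideal_of G).
Proof. exact: asboolP. Qed.

Lemma ideal_of_gen x : G x -> x \in ideal_of G.
Proof.
move=> Gx; apply/ideal_ofP; exists [:: (1, x)].
by rewrite big_seq1 mul1r; split=> // u; rewrite inE => /eqP->.
Qed.

Lemma ideal_ofM a x : x \in ideal_of G -> a * x \in ideal_of G.
Proof.
move=> /ideal_ofP[s [sG ->]]; apply/ideal_ofP.
exists [seq (a * u.1, u.2) | u <- s]; split.
  by move=> _ /mapP[u us ->]; apply: (sG u).
by rewrite big_map mulr_sumr; apply: eq_bigr => u _; rewrite mulrA.
Qed.

Lemma ideal_of_zmod : zmod_closed (ideal_of G).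
Proof.
split; first by apply/ideal_ofP; exists [::]; rewrite big_nil.
move=> x y Ix /(ideal_ofM (-1)); rewrite mulN1r.
move: Ix => /ideal_ofP[s [sG ->]] /ideal_ofP[t [tG ->]]; apply/ideal_ofP.
exists (s ++ t); rewrite big_cat; split=> // u.
by rewrite mem_cat => /orP[/sG|/tG].
Qed.

HB.instance Definition _ :=
  GRing.isZmodClosed.Build P (ideal_of G) ideal_of_zmod.

Definition ideal_zmod : zmodClosed P :=
  GRing.ZmodClosed.clone P (ideal_of G) _.

(* The ring structure on {ideal_quot _} requires a proper ideal; only its
   additive group is reused here. *)
Definition quot_ring : Type := {ideal_quot ideal_zmod}.
HB.instance Definition _ := GRing.Zmodule.on quot_ring.

Definition qproj (x : P) : quot_ring := \pi_({ideal_quot ideal_zmod})%qT x.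

Lemma qproj_eq x y : (qproj x = qproj y) <-> in_ideal G (x - y).
Proof.
split=> [/eqP|Ixy]; first by rewrite -Quotient.idealrBE => /ideal_ofP.
by apply/eqP; rewrite -Quotient.idealrBE; apply/ideal_ofP.
Qed.

Lemma qproj_surj (z : quot_ring) : exists x, z = qproj x.
Proof. by exists (repr z); rewrite /qproj reprK. Qed.

Lemma qproj_zmod : zmod_morphism qproj.
Proof. exact: pi_is_zmod_morphism. Qed.
HB.instance Definition _ :=
  GRing.isZmodMorphism.Build P quot_ring qproj qproj_zmod.

Definition quot_one : quot_ring := qproj 1.
Definition quot_mul (z w : quot_ring) : quot_ring := qproj (repr z * repr w).

Lemma qprojM x y : qproj (x * y) = quot_mul (qproj x) (qproj y).
Proof.
apply/qproj_eq/ideal_ofP.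
have rK z : z - repr (qproj z) \in ideal_of G.
  by apply/ideal_ofP/qproj_eq; rewrite /qproj reprK.
rewrite -(subrKA (x * repr (qproj y))) -mulrBr -mulrBl.
by apply: rpredD; [|rewrite mulrC]; apply: ideal_ofM.
Qed.

Let mulA : associative quot_mul.
Proof.
move=> x y z; have [[a ->] [b ->] [c ->]] :=
  And3 (qproj_surj x) (qproj_surj y) (qproj_surj z).
by rewrite -!qprojM mulrA.
Qed.
Let mulC : commutative quot_mul.
Proof. by move=> x y; rewrite /quot_mul mulrC. Qed.
Let mul1 : left_id quot_one quot_mul.
Proof. by move=> x; have [a ->] := qproj_surj x; rewrite -qprojM mul1r. Qed.
Let mulD : left_distributive quot_mul +%R.
Proof.
move=> x y z; have [[a ->] [b ->] [c ->]] :=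
  And3 (qproj_surj x) (qproj_surj y) (qproj_surj z).
by rewrite -raddfD -!qprojM mulrDl raddfD.
Qed.

HB.instance Definition _ :=
  GRing.Zmodule_isComPzRing.Build quot_ring mulA mulC mul1 mulD.

Lemma qproj_monoid : monoid_morphism qproj.
Proof. by split=> // x y; apply: qprojM. Qed.
HB.instance Definition _ :=
  GRing.isMonoidMorphism.Build P quot_ring qproj qproj_monoid.
End IdealQuotient.

Section PowerSeries.
Variable R : comPzRingType.

Record powser := PowSer { pscoef : nat -> R }.

HB.instance Definition _ := gen_eqMixin powser.
HB.instance Definition _ := gen_choiceMixin powser.

Lemma powserP (a b : powser) : pscoef a =1 pscoef b <-> a = b.
Proof. by split=> [|->//]; case: a b => a [b] /= /funext ->. Qed.

Definition ps_zero := PowSer (fun=> 0).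
Definition ps_opp a := PowSer (fun n => - pscoef a n).
Definition ps_add a b := PowSer (fun n => pscoef a n + pscoef b n).
Definition psC (c : R) := PowSer (fun n => if n is 0 then c else 0).
Definition ps_mul a b :=
  PowSer (fun n => \sum_(i < n.+1) pscoef a i * pscoef b (n - i)).

Let addA : associative ps_add.
Proof. by move=> a b c; apply/powserP => n /=; rewrite addrA. Qed.
Let addC : commutative ps_add.
Proof. by move=> a b; apply/powserP => n /=; rewrite addrC. Qed.
Let add0 : left_id ps_zero ps_add.
Proof. by move=> a; apply/powserP => n /=; rewrite add0r. Qed.
Let addN : left_inverse ps_zero ps_opp ps_add.
Proof. by move=> a; apply/powserP => n /=; rewrite addNr. Qed.

HB.instance Definition _ := GRing.isZmodule.Build powser addA addC add0 addN.

Let mulC : commutative ps_mul.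
Proof.
move=> a b; apply/powserP => n /=; rewrite (reindex_inj rev_ord_inj) /=.
by apply: eq_bigr => j _; rewrite mulrC subSS subKn // -ltnS.
Qed.
Let mulA : associative ps_mul.
Proof.
move=> a b c; apply/powserP => i; rewrite [ps_mul b c]mulC /=.
pose coef3 j k := pscoef a j * (pscoef b (i - j - k) * pscoef c k).
transitivity (\sum_(j < i.+1) \sum_(k < i.+1 | (k <= i - j)%N) coef3 j k).
  apply: eq_bigr => /= j _; rewrite big_distrr /=.
  rewrite (big_ord_narrow_leq (leq_subr _ _)).
  by apply: eq_bigr => k _; rewrite /coef3 [pscoef c _ * _]mulrC.
rewrite (exchange_big_dep predT) //=.
rewrite [RHS](reindex_inj rev_ord_inj) /=; apply: eq_bigr => k _.
transitivity (\sum_(j < i.+1 | (j <= i - k)%N) coef3 j k).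
  apply: eq_bigl => j; rewrite -ltnS -(ltnS j) -!subSn ?leq_ord //.
  by rewrite -subn_gt0 -(subn_gt0 j) -!subnDA addnC.
rewrite subSS subKn ?leq_ord // (big_ord_narrow_leq (leq_subr _ _)) big_distrl.
by apply: eq_bigr => j _; rewrite /coef3 -!subnDA addnC mulrA.
Qed.
Let mul1 : left_id (psC 1) ps_mul.
Proof.
move=> a; apply/powserP => n /=.
by rewrite big_ord_recl /= mul1r subn0 big1 ?addr0 // => j _; rewrite mul0r.
Qed.
Let mulD : left_distributive ps_mul ps_add.
Proof.
move=> a b c; apply/powserP => n /=; rewrite -big_split /=.
by apply: eq_bigr => j _; rewrite mulrDl.
Qed.

HB.instance Definition _ :=
  GRing.Zmodule_isComPzRing.Build powser mulA mulC mul1 mulD.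

Lemma psC_zmod : zmod_morphism psC.
Proof. by move=> a b; apply/powserP => -[|n] //=; rewrite subr0. Qed.
Lemma psC_monoid : monoid_morphism psC.
Proof.
split=> // a b; apply/powserP => -[|n] /=; first by rewrite big_ord1.
rewrite big_ord_recl /= mulr0 add0r big1 // => j _; exact: mul0r.
Qed.
HB.instance Definition _ := GRing.isZmodMorphism.Build R powser psC psC_zmod.
HB.instance Definition _ :=
  GRing.isMonoidMorphism.Build R powser psC psC_monoid.
End PowerSeries.

Section AlgHom.
Variables (A S T : comPzRingType).

Record algHom (s : {rmorphism A -> S}) (t : {rmorphism A -> T}) := AlgHom {
  ahom :> {rmorphism S -> T};
  ahomE : forall a, ahom (s a) = t a
}.

Lemma algHom_ext s t (h1 h2 : algHom s t) : h1 =1 h2 -> h1 = h2.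
Proof.
case: h1 h2 => [[h1 c1] e1] [[h2 c2] e2] /= /funext eqh.
move: c1 c2 e1 e2; rewrite {}eqh => -[[p1] [q1]] [[p2] [q2]].
rewrite (Prop_irrelevance p1 p2) (Prop_irrelevance q1 q2) => e1 e2.
by rewrite (Prop_irrelevance e1 e2).
Qed.
End AlgHom.

Section AlgHomComp.
Variables (A S T U : comPzRingType) (s : {rmorphism A -> S})
  (t : {rmorphism A -> T}) (u : {rmorphism A -> U}).

Lemma ahom_comp_subproof (h2 : algHom t u) (h1 : algHom s t) a :
  h2 (h1 (s a)) = u a.
Proof. by rewrite !ahomE. Qed.

Definition ahom_comp (h2 : algHom t u) (h1 : algHom s t) : algHom s u :=
  @AlgHom A S U s u (h2 \o h1) (ahom_comp_subproof h2 h1).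
End AlgHomComp.

(* The order m is an [option nat], with None for infinity. *)
Definition le_order (i : nat) (m : option nat) : bool :=
  if m is Some n then (i <= n)%N else true.

Definition idx (m : option nat) := {i : nat | le_order i m}.
Definition pos_idx (m : option nat) := {i : idx m | (0 < val i)%N}.

Lemma le_order0 m : le_order 0 m. Proof. by case: m. Qed.
Lemma le_order_trans i j m : (i <= j)%N -> le_order j m -> le_order i m.
Proof. by case: m => //= n; apply: leq_trans. Qed.

Definition idx0 m : idx m := exist _ 0%N (le_order0 m).

Section Idx.
Variables (m : option nat) (k : idx m) (i : 'I_(val k).+1).

Lemma idx_lo_subproof : le_order i m.
Proof. by apply: (le_order_trans _ (valP k)); rewrite -ltnS. Qed.
Lemma idx_hi_subproof : le_order (val k - i) m.
Proof. exact: (le_order_trans (leq_subr _ _) (valP k)). Qed.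

(* i + j = k is parametrised by i <= k, with i = idx_lo and j = idx_hi. *)
Definition idx_lo : idx m := exist _ (i : nat) idx_lo_subproof.
Definition idx_hi : idx m := exist _ (val k - i)%N idx_hi_subproof.
End Idx.

Section HasseSchmidt.
Variables (A B : comPzRingType) (f : {rmorphism A -> B}) (m : option nat).

Definition hs_vars : choiceType := (B * pos_idx m)%type.

(* x^(i), with x^(0) identified with the constant x. *)
Definition hs_var (i : idx m) (x : B) : mvpoly B hs_vars :=
  if insub i is Some j then mvpolyX B ((x, j) : hs_vars)
  else mvpolyC hs_vars x.

Variant hs_rel : mvpoly B hs_vars -> Prop :=
| HsAdd (x y : B) (i : idx m) of (0 < val i)%N :
    hs_rel (hs_var i (x + y) - hs_var i x - hs_var i y)
| HsConst (a : A) (i : idx m) of (0 < val i)%N :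
    hs_rel (hs_var i (f a))
| HsMul (x y : B) (k : idx m) :
    hs_rel (hs_var k (x * y) -
      \sum_(i < (val k).+1) hs_var (idx_lo i) x * hs_var (idx_hi i) y).

Definition HS : comPzRingType := quot_ring hs_rel.

Definition hs_d (i : idx m) (x : B) : HS := qproj hs_rel (hs_var i x).

Definition hs_alg : {rmorphism A -> HS} :=
  qproj hs_rel \o mvpolyC hs_vars \o f.

Lemma hs_var0 x : hs_var (idx0 m) x = mvpolyC hs_vars x.
Proof. by rewrite /hs_var insubF. Qed.

Lemma hs_algE a : hs_alg a = hs_d (idx0 m) (f a).
Proof. by rewrite /hs_d hs_var0. Qed.

Lemma hs_rel0 p : hs_rel p -> qproj hs_rel p = 0.
Proof.
move=> rp; rewrite -(raddf0 (qproj hs_rel)); apply/qproj_eq.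
by rewrite subr0; apply/ideal_ofP/ideal_of_gen.
Qed.
End HasseSchmidt.

Section HigherDerivations.
Variables (A B R : comPzRingType).
Variables (f : {rmorphism A -> B}) (g : {rmorphism A -> R}) (m : option nat).

Record is_higher_der (D : idx m -> B -> R) : Prop := {
  hd_alg : exists h : algHom f g, D (idx0 m) =1 h;
  hd_zmod : forall i, (0 < val i)%N -> zmod_morphism (D i);
  hd_const : forall i, (0 < val i)%N -> forall a, D i (f a) = 0;
  hd_mul : forall k x y,
    D k (x * y) = \sum_(i < (val k).+1) D (idx_lo i) x * D (idx_hi i) y
}.

Definition higher_der := {D : idx m -> B -> R | is_higher_der D}.
End HigherDerivations.

(* R[t]/(t^(n+1)), resp. R[[t]]; R[t] is mvpoly R tvars, with a single variable. *)
Definition tvars : choiceType := unit.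

Section Jets.
Variable R : comPzRingType.

Definition vart : mvpoly R tvars := mvpolyX R (tt : tvars).

Definition tpow (n : nat) (p : mvpoly R tvars) : Prop := p = vart ^+ n.+1.

Definition trunc_poly (n : nat) : comPzRingType := quot_ring (@tpow n).

Definition jet_ring (m : option nat) : comPzRingType :=
  if m is Some n then trunc_poly n else powser R.

Definition jetC (m : option nat) : {rmorphism R -> jet_ring m} :=
  match m return {rmorphism R -> jet_ring m} with
  | Some n => qproj (@tpow n) \o mvpolyC tvars
  | None => @psC R
  end.

(* The class of c_0 + c_1 t + ... + c_m t^m, resp. the series with
   coefficients c_i. *)
Definition jet (m : option nat) : (idx m -> R) -> jet_ring m :=
  match m return (idx m -> R) -> jet_ring m with
  | Some n => fun c => qproj (@tpow n)
      (\sum_(i < n.+1) mvpolyC tvars (c (@exist _ _ (i : nat) (leq_ord i)))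
                       * vart ^+ i)
  | None => fun c => PowSer (fun i => c (exist _ i isT))
  end.
End Jets.

Arguments jet {R m} c.


Section JetTheory.
Variables (R : comPzRingType) (m : option nat).
Implicit Types (c d : idx m -> R).

Lemma convol_nilp (Q : comPzRingType) (n : nat) (T : Q) (a b : nat -> Q) :
  T ^+ n.+1 = 0 ->
  \sum_(k < n.+1) (\sum_(i < k.+1) a i * b (k - i)%N) * T ^+ k =
  (\sum_(i < n.+1) a i * T ^+ i) * (\sum_(i < n.+1) b i * T ^+ i).
Proof.
move=> T0; set N := n.+1.
transitivity (\sum_(k < N) \sum_(i < N | (i < k.+1)%N)
    a i * b (k - i)%N * T ^+ k).
  apply: eq_bigr => k _; rewrite big_distrl /=.
  by rewrite (big_ord_widen N (fun i => a i * b (k - i)%N * T ^+ k)).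
rewrite (exchange_big_dep predT) //= big_distrl /=; apply: eq_bigr => i _.
transitivity (\sum_(i <= k < N) a i * b (k - i)%N * T ^+ k).
  rewrite big_geq_mkord; apply: eq_bigl => k; first by rewrite ltnS.
rewrite -{1}[i : nat]add0n big_addn mulr_sumr.
rewrite -[RHS](big_mkord xpredT (fun j => a i * T ^+ i * (b j * T ^+ j))).
rewrite [RHS](big_cat_nat _ (leq_subr i N)) //=.
rewrite [X in _ = _ + X]big_nat [X in _ = _ + X]big1 ?addr0.
  by apply: eq_bigr => j _; rewrite addnK addnC exprD mulrACA mulrA.
move=> j /andP[lej _]; rewrite mulrACA -exprD -(subnK (_ : N <= i + j)%N).
  by rewrite exprD T0 !mulr0.
by rewrite -leq_subLR.
Qed.

Lemma jetB c d : jet (fun i => c i - d i) = jet c - jet d.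
Proof.
case: m c d => [n|] c d /=; last exact/powserP.
rewrite -raddfB -sumrB; congr qproj; apply: eq_bigr => i _.
by rewrite raddfB mulrBl.
Qed.

Lemma jet_const c r : c (idx0 m) = r ->
  (forall i, (0 < val i)%N -> c i = 0) -> jet c = jetC R m r.
Proof.
case: m c => [n|] c c0 ci.
  transitivity (qproj (@tpow R n) (mvpolyC tvars r)); last exact: erefl.
  apply: (congr1 (qproj (@tpow R n))).
  rewrite big_ord_recl expr0 mulr1.
  rewrite big1 ?addr0 => [|i _].
    by apply: (congr1 (mvpolyC _)); rewrite -c0; congr c; apply: val_inj.
  by rewrite ci // raddf0 mul0r.
apply/powserP => -[|i] /=; last by rewrite ci.
by rewrite -c0; congr c; apply: val_inj.
Qed.

Lemma jetM c d :
  jet (fun k => \sum_(i < (val k).+1) c (idx_lo i) * d (idx_hi i)) =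
  jet c * jet d.
Proof.
case: m c d => [n|] c d /=; last first.
  apply/powserP => k /=; apply: eq_bigr => i _.
  by congr (c _ * d _); apply: val_inj.
pose ext (e : idx (Some n) -> R) i := oapp e 0 (insub i).
have extE e (i : idx (Some n)) : ext e (val i) = e i by rewrite /ext valK.
pose I := @tpow R n.
pose C := qproj I \o mvpolyC tvars : {rmorphism R -> _}.
pose T := qproj I (vart R).
have jetE (F : nat -> R) :
    qproj I (\sum_(i < n.+1) mvpolyC tvars (F i) * vart R ^+ i)
    = \sum_(i < n.+1) C (F i) * T ^+ i.
  by rewrite rmorph_sum; apply: eq_bigr => i _; rewrite rmorphM rmorphXn.
transitivity (qproj I (\sum_(k < n.+1) mvpolyC tvars
    (\sum_(i < k.+1) ext c i * ext d (k - i)%N) * vart R ^+ k)).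
  congr qproj; apply: eq_bigr => k _; congr (mvpolyC _ _ * _).
  by apply: eq_bigr => i _; rewrite -!extE.
transitivity (qproj I (\sum_(i < n.+1) mvpolyC tvars (ext c i) * vart R ^+ i)
   * qproj I (\sum_(i < n.+1) mvpolyC tvars (ext d i) * vart R ^+ i)); last first.
  by congr (qproj _ _ * qproj _ _); apply: eq_bigr => k _; rewrite -[RHS]/(_ * _) -extE.
rewrite !jetE (jetE (fun k => \sum_(i < k.+1) ext c i * ext d (k - i)%N)).
rewrite -(convol_nilp (fun i => C (ext c i)) (fun i => C (ext d i))).
  apply: eq_bigr => k _; congr (_ * _); rewrite rmorph_sum.
  by apply: eq_bigr => i _; rewrite rmorphM.
rewrite -rmorphXn -(raddf0 (qproj I)); apply/qproj_eq.
by rewrite subr0; apply/ideal_ofP/ideal_of_gen.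
Qed.
End JetTheory.

Section Maps.
Variables (A B R : comPzRingType).
Variables (f : {rmorphism A -> B}) (g : {rmorphism A -> R}) (m : option nat).

(* R[t]/(t^(m+1)), resp. R[[t]], as an A-algebra. *)
Definition jet_alg : {rmorphism A -> jet_ring R m} := jetC R m \o g.

Section DerToJet.
Variable D : higher_der f g m.

Definition der_to_jet_fun (x : B) : jet_ring R m := jet (fun i => sval D i x).

Lemma hderB i : zmod_morphism (sval D i).
Proof.
case: D => D' [[h Dh] DB _ _] /= x y.
have [i0|] := posnP (val i); last by move/DB; apply.
by rewrite (_ : i = idx0 m) ?Dh ?raddfB //; apply: val_inj.
Qed.

Lemma der_to_jet_zmod : zmod_morphism der_to_jet_fun.
Proof.
move=> x y; rewrite -jetB; congr jet; apply/funext => i; exact: hderB.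
Qed.

Lemma der_to_jetE a : der_to_jet_fun (f a) = jet_alg a.
Proof.
rewrite /der_to_jet_fun; case: D => D' [[h Dh] _ Dc _] /=.
by apply: jet_const => [|i /Dc]; rewrite ?Dh ?ahomE.
Qed.

Lemma der_to_jet_monoid : monoid_morphism der_to_jet_fun.
Proof.
split=> [|x y]; first by rewrite -(rmorph1 f) der_to_jetE rmorph1.
rewrite -jetM; congr jet; apply/funext => i.
exact: (hd_mul (svalP D)).
Qed.

HB.instance Definition _ := GRing.isZmodMorphism.Build B (jet_ring R m)
  der_to_jet_fun der_to_jet_zmod.
HB.instance Definition _ := GRing.isMonoidMorphism.Build B (jet_ring R m)
  der_to_jet_fun der_to_jet_monoid.

Definition der_to_jet : algHom f jet_alg :=
  @AlgHom A B (jet_ring R m) f jet_alg der_to_jet_fun der_to_jetE.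
End DerToJet.

Section HsToDer.
Variable phi : algHom (hs_alg f m) g.

Lemma hs_to_der_subproof :
  is_higher_der f g (fun (i : idx m) x => phi (hs_d f i x)).
Proof.
have E a : phi (hs_d f (idx0 m) (f a)) = g a by rewrite -hs_algE ahomE.
have d0E x : hs_d f (idx0 m) x = qproj (hs_rel f (m := m)) (mvpolyC _ x).
  by rewrite /hs_d hs_var0.
split=> [|i i0 x y|i i0 a|k x y].
- pose h : {rmorphism B -> R} :=
    phi \o (qproj (hs_rel f (m := m)) \o mvpolyC (hs_vars B m)).
  have hE a : h (f a) = g a by rewrite -E d0E.
  by exists (AlgHom hE) => x; rewrite d0E.
- have := hs_rel0 (HsAdd f (x - y) y i0); rewrite subrK !raddfB => /eqP.
  rewrite subr_eq add0r subr_eq => /eqP e.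
  have {}e : hs_d f i x = hs_d f i y + hs_d f i (x - y) := e.
  by rewrite e raddfD addrAC subrr add0r.
- by rewrite -(rmorph0 phi) -(hs_rel0 (HsConst f a i0)).
have := hs_rel0 (HsMul f x y k); rewrite raddfB => /eqP.
rewrite subr_eq0 => /eqP e.
have {}e : hs_d f k (x * y) = qproj (hs_rel f (m := m))
    (\sum_(i < (val k).+1) hs_var (idx_lo i) x * hs_var (idx_hi i) y) := e.
by rewrite e !rmorph_sum; apply: eq_bigr => i _; rewrite !rmorphM.
Qed.

Definition hs_to_der : higher_der f g m :=
  exist _ (fun i x => phi (hs_d f i x)) hs_to_der_subproof.

Definition hs_to_jet_fun (x : B) : jet_ring R m :=
  jet (fun i => phi (hs_d f i x)).

HB.instance Definition _ := GRing.isZmodMorphism.Build B (jet_ring R m)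
  hs_to_jet_fun (der_to_jet_zmod hs_to_der).
HB.instance Definition _ := GRing.isMonoidMorphism.Build B (jet_ring R m)
  hs_to_jet_fun (der_to_jet_monoid hs_to_der).

Definition hs_to_jet : algHom f jet_alg :=
  @AlgHom A B (jet_ring R m) f jet_alg hs_to_jet_fun (der_to_jetE hs_to_der).
End HsToDer.
End Maps.

(* Main.v *)
Require Import Defs.
From HB Require Import structures.
From mathcomp Require Import all_boot all_algebra.
From mathcomp Require Import ring_quotient finmap boolp monalg.

Set Implicit Arguments.
Unset Strict Implicit.
Unset Printing Implicit Defensive.

Import GRing.Theory.
Local Open Scope ring_scope.

(** Both bijections express that an object is determined by free data.

    A homomorphism out of the Hasse-Schmidt algebra is a homomorphism out of a
    polynomial ring over [B], that is, a homomorphism on [B] together with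
    arbitrary values on the variables [x^(i)], subject to killing the
    generators of the ideal ([mvpoly_lift], [quot_lift]).  The three families
    of generators say exactly that the components are additive, vanish on [A]
    and satisfy the Leibniz rule, so such data amount to a higher derivation
    ([hs_to_der_inj], [hs_to_der_surj]).

    An element of [R[t]/(t^(m+1))], resp. [R[[t]]], is the jet of one and only
    one coefficient sequence ([jet_inj], [jet_surj]).  Transported to
    coefficients, addition is termwise and multiplication is convolution
    ([jetB], [jetM]); hence a map of [B] to jets is a ring homomorphism exactly
    when its coefficients are additive, satisfy the Leibniz rule and send [1] to
    the coefficients of [1]; it is compatible with [A] exactly when its
    constant coefficient is and those of positive order kill [A]
    ([der_to_jet_inj], [der_to_jet_surj]).

    Naturality in [R] comes from applying [u] to each coefficient ([jet_map]).
    Naturality in [B] comes from the first bijection with target the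
    Hasse-Schmidt algebra of [B]: the universal derivation [d] composed with
    [h] is a higher derivation on [B'] ([hs_map]). *)

(** * Constructing bijections and homomorphisms *)

Lemma inj_surj_bij (X Y : Type) (F : X -> Y) :
  injective F -> (forall y, exists x, F x = y) -> bijective F.
Proof.
move=> Finj /choice[G GK].
by exists G => // x; apply: Finj; rewrite GK.
Qed.

Lemma rmorphism_of_fun (S T : comPzRingType) (F : S -> T) :
  zmod_morphism F -> monoid_morphism F -> exists h : {rmorphism S -> T}, h =1 F.
Proof.
move=> FB FM.
pose hB := GRing.isZmodMorphism.Build S T F FB.
pose hM := GRing.isMonoidMorphism.Build S T F FM.
pose h : {rmorphism S -> T} := HB.pack F hB hM.
by exists h.
Qed.

Lemma algHom_of_fun (A S T : comPzRingType) (s : {rmorphism A -> S})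
    (t : {rmorphism A -> T}) (F : S -> T) :
  zmod_morphism F -> monoid_morphism F -> (forall a, F (s a) = t a) ->
  exists h : algHom s t, h =1 F.
Proof.
move=> FB FM FE; have [h hE] := rmorphism_of_fun FB FM.
have he a : h (s a) = t a by rewrite hE.
by exists (AlgHom he).
Qed.

(** * Multivariate polynomials *)

Section MvPolyTheory.
Variables (R : comPzRingType) (I : choiceType).
Implicit Types (p q : mvpoly R I) (k l : {cmonom I}).

Definition mvmon (a : R) k : mvpoly R I := mkmalgU k a.

(** The product on [mvpoly] is defined by sums over supports, and the support
    of a monomial is empty when its coefficient vanishes; hence the case
    distinctions. *)
Lemma mvmonM a b k l : mvmon a k * mvmon b l = mvmon (a * b) (mmul k l).
Proof.
(* Stated for opaque p and q, so that rewriting with the value of one support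
   never compares the other one by unfolding the two monomials. *)
have gen p q : msupp p = (if a == 0 then fset0 else [fset k])%fset ->
    msupp q = (if b == 0 then fset0 else [fset l])%fset ->
    mcoeff k p = a -> mcoeff l q = b -> p * q = mvmon (a * b) (mmul k l).
  move=> sp sq pk ql; transitivity (mvpoly_mul p q) => //.
  rewrite mvpoly_mul.unlock sp sq.
  have [->|_] := eqVneq a 0; first by rewrite big_seq_fset0 mul0r /mvmon monalgU0.
  rewrite big_seq_fset1; have [->|_] := eqVneq b 0.
    by rewrite big_seq_fset0 mulr0 /mvmon monalgU0.
  by rewrite big_seq_fset1 pk ql.
apply: gen; [exact: msuppU | exact: msuppU | exact: mcoeffUU | exact: mcoeffUU].
Qed.

Lemma mvpolyCE a : mvpolyC I a = mvmon a mone.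
Proof. by rewrite mvpolyC.unlock. Qed.

Lemma mvpolyXE i : mvpolyX R i = mvmon 1 (ucm i).
Proof. by rewrite mvpolyX.unlock. Qed.

Lemma mvpolyE p : p = \sum_(k <- msupp p) mvmon (mcoeff k p) k.
Proof. exact: monalgE. Qed.

(** A subring containing the constants and the variables is everything.  This
    gives both uniqueness of homomorphisms out of a polynomial ring and
    the description of its quotients.  Closure is asked under subtraction since
    that is what the morphism laws [rmorphB] and [jetB] give directly. *)
Lemma mvpoly_ind (P : mvpoly R I -> Prop) :
  (forall a, P (mvpolyC I a)) -> (forall i, P (mvpolyX R i)) ->
  (forall p q, P p -> P q -> P (p - q)) ->
  (forall p q, P p -> P q -> P (p * q)) ->
  forall p, P p.
Proof.
move=> PC PX PB PM.
have P0 : P 0 by rewrite -(raddf0 (mvpolyC I)); apply: PC.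
have PD p q : P p -> P q -> P (p + q).
  move=> Pp Pq; have : P (p - (0 - q)) by apply: (PB) => //; apply: (PB).
  by rewrite sub0r opprK.
(* A monomial of positive degree is divisible by one of its variables. *)
have Pmon n k : mdeg k = n -> P (mvmon 1 k).
  elim: n k => [|n IH] k; first by move/mdeg_eq0I->; rewrite -mvpolyCE.
  have [->|] := eqVneq k mone; first by rewrite mdeg1.
  move=> k1 dk; have [i ki] : exists i, k i != 0%N.
    apply: contrapT => nk; case/eqP: k1; apply/eqP/cmP => i; rewrite cm1.
    by apply/eqP/negPn/negP => ki; apply: nk; exists i.
  have kE : k = mmul (ucm i) (divcm k (ucm i)).
    apply/eqP/cmP => j; rewrite cmM divcmE cmU subnKC //.
    by case: eqP => // <-; rewrite lt0n.
  rewrite kE -[1]mulr1 -mvmonM -mvpolyXE; apply: PM => //; apply: IH.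
  by move: dk; rewrite {1}kE mdegM mdegU => -[].
move=> p; rewrite [p]mvpolyE; elim/big_ind: _ => // k _.
by rewrite -[mcoeff k p]mulr1 -[k in mvmon _ k]mul1m -mvmonM -mvpolyCE; eauto.
Qed.

Section Eval.
Variables (S : comPzRingType) (phi : {rmorphism R -> S}) (v : I -> S).

Definition moneval k : S := \prod_(i <- finsupp k) v i ^+ k i.

(** Sums and products over supports can only be compared termwise once they
    range over a common finite set. *)
Lemma moneval_widen k (d : {fset I}) : (finsupp k `<=` d)%fset ->
  moneval k = \prod_(i <- d) v i ^+ k i.
Proof.
move=> le; rewrite /moneval (big_fset_incl _ le) // => i _.
by rewrite -cmE_neq0 negbK => /eqP->.
Qed.

Lemma moneval1 : moneval mone = 1.
Proof. by rewrite /moneval mdom1 big_seq_fset0. Qed.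

Lemma monevalU i : moneval (ucm i) = v i.
Proof. by rewrite /moneval mdomU big_seq_fset1 cmUU. Qed.

Lemma monevalM k l : moneval (mmul k l) = moneval k * moneval l.
Proof.
rewrite (@moneval_widen k _ (fsubsetUl _ (finsupp l))).
rewrite (@moneval_widen l _ (fsubsetUr (finsupp k) _)) /moneval mdomD -big_split /=.
by apply: eq_bigr => i _; rewrite cmM exprD.
Qed.

Definition mveval p : S := \sum_(k <- msupp p) phi (mcoeff k p) * moneval k.

Lemma mveval_widen p (d : {fset {cmonom I}}) : (msupp p `<=` d)%fset ->
  mveval p = \sum_(k <- d) phi (mcoeff k p) * moneval k.
Proof.
move=> le; rewrite /mveval (big_fset_incl _ le) // => k _ /mcoeff_outdom->.
by rewrite raddf0 mul0r.
Qed.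

Lemma mveval_mon a k : mveval (mvmon a k) = phi a * moneval k.
Proof. by rewrite (mveval_widen msuppU_le) big_seq_fset1 mcoeffUU. Qed.

Lemma mveval_zmod : zmod_morphism mveval.
Proof.
move=> p q.
have le1 := fsubsetUl (msupp p) (msupp q).
have le2 := fsubsetUr (msupp p) (msupp q).
rewrite (mveval_widen (msuppB_le p q)) (mveval_widen le1) (mveval_widen le2).
by rewrite -sumrB; apply: eq_bigr => k _; rewrite mcoeffB raddfB mulrBl.
Qed.

HB.instance Definition _ :=
  GRing.isZmodMorphism.Build (mvpoly R I) S mveval mveval_zmod.

Lemma mveval_monoid : monoid_morphism mveval.
Proof.
split=> [|p q].
  have -> : 1 = mvmon 1 mone by rewrite -mvpolyCE rmorph1.
  by rewrite mveval_mon rmorph1 moneval1 mulr1.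
rewrite {1}[p]mvpolyE {1}[q]mvpolyE mulr_suml raddf_sum [in RHS]/mveval mulr_suml.
apply: eq_bigr => k _; rewrite !mulr_sumr raddf_sum.
apply: eq_bigr => l _.
by rewrite mvmonM [LHS]mveval_mon rmorphM monevalM mulrACA.
Qed.

(** Universal property of the polynomial ring, for rings that may be zero. *)
Lemma mvpoly_lift : exists ev : {rmorphism mvpoly R I -> S},
  (forall a, ev (mvpolyC I a) = phi a) /\ (forall i, ev (mvpolyX R i) = v i).
Proof.
have [ev evE] := rmorphism_of_fun mveval_zmod mveval_monoid.
exists ev; split=> [a|i]; rewrite evE.
  by rewrite mvpolyCE mveval_mon moneval1 mulr1.
by rewrite mvpolyXE mveval_mon monevalU rmorph1 mul1r.
Qed.

End Eval.
End MvPolyTheory.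

(** * Quotient rings *)

(** A homomorphism that kills the generators kills the ideal, so its value at
    the chosen representative of a class does not depend on the choice. *)
Lemma quot_lift (P S : comPzRingType) (G : P -> Prop) (h : {rmorphism P -> S}) :
  (forall x, G x -> h x = 0) ->
  exists H : {rmorphism quot_ring G -> S}, forall x, H (qproj G x) = h x.
Proof.
move=> hG; pose F (z : quot_ring G) := h (repr z).
have FE x : F (qproj G x) = h x.
  have [s [sG sE]] : in_ideal G (repr (qproj G x) - x).
    by apply/qproj_eq; rewrite /qproj reprK.
  apply/eqP; rewrite -subr_eq0 -rmorphB sE rmorph_sum big_seq.
  by rewrite big1 // => u /sG/hG; rewrite rmorphM => ->; rewrite mulr0.
have FB : zmod_morphism F.
  move=> z w; have [[x ->] [y ->]] := (qproj_surj z, qproj_surj w).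
  by rewrite -raddfB !FE raddfB.
have FM : monoid_morphism F.
  split=> [|z w]; first by rewrite -(rmorph1 (qproj G)) FE rmorph1.
  have [[x ->] [y ->]] := (qproj_surj z, qproj_surj w).
  by rewrite -rmorphM !FE rmorphM.
by have [H HE] := rmorphism_of_fun FB FM; exists H => x; rewrite HE FE.
Qed.

(** * Coefficients of jets *)

Section PowerSeriesVariable.
Variable R : comPzRingType.
Implicit Types s : powser R.

Definition psX : powser R := PowSer (fun n => (n == 1)%:R).

Lemma pscoefXM s n :
  pscoef (psX * s) n = if n is n'.+1 then pscoef s n' else 0.
Proof.
rewrite [LHS]/= big_ord_recl mul0r add0r.
case: n => [|n]; first by rewrite big_ord0.
rewrite big_ord_recl mul1r big1 ?addr0 ?subSS ?subn0 // => i _.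
by rewrite mul0r.
Qed.

(** A multiple of [t^k] has no coefficient below [k]; this is what makes the
    first [n+1] coefficients well defined modulo [t^(n+1)]. *)
Lemma pscoefXnM s k n :
  pscoef (psX ^+ k * s) n = if (n < k)%N then 0 else pscoef s (n - k).
Proof.
elim: k n => [|k IH] n; first by rewrite mul1r subn0.
by rewrite exprS -mulrA pscoefXM; case: n => // n; rewrite IH.
Qed.

Lemma pscoef_sum (T : Type) (r : seq T) (F : T -> powser R) n :
  pscoef (\sum_(i <- r) F i) n = \sum_(i <- r) pscoef (F i) n.
Proof. exact: (big_morph (fun s => pscoef s n)). Qed.
End PowerSeriesVariable.

Section JetBijection.
Variables (R : comPzRingType).

(** For finite order, expand the polynomial as a power series: a multiple of
    [t^(n+1)] has zero coefficients up to [n], while the coefficients of the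
    polynomial representing [jet c] are those of [c]. *)
Lemma jet_eq0 m (c : idx m -> R) : jet c = 0 -> forall i, c i = 0.
Proof.
case: m c => [n|] c; last first.
  by move=> /powserP c0 [i li]; apply: etrans (c0 i); congr c; apply: val_inj.
rewrite -(raddf0 (qproj (@tpow R n))) => /qproj_eq[s [sG]]; rewrite subr0 => cE.
have [ev [evC evX]] := mvpoly_lift (@psC R) (fun _ : tvars => psX R).
have evt : ev (vart R) = psX R by apply: evX.
move=> [k lk]; have := congr1 (fun p => pscoef (ev p) k) cE.
rewrite !rmorph_sum !pscoef_sum.
rewrite [RHS]big_seq [RHS]big1 => [|u /sG ->]; last first.
  by rewrite rmorphM rmorphXn evt mulrC pscoefXnM ltnS (lk : (k <= n)%N).
(* Only the term of index k contributes to the coefficient of t^k. *)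
rewrite (bigD1 (Ordinal (lk : (k < n.+1)%N))) //= big1 ?addr0 => [<-|i ik].
  rewrite rmorphM rmorphXn evt evC mulrC pscoefXnM ltnn subnn /=.
  by congr c; apply: val_inj.
rewrite rmorphM rmorphXn evt evC mulrC pscoefXnM.
case: ltnP => // leik; have : (0 < k - i)%N.
  rewrite subn_gt0 ltn_neqAle leik andbT.
  by apply: contra ik => /eqP ik; apply/eqP/val_inj.
by case: (k - i)%N.
Qed.

Lemma jet_inj m : injective (@jet R m).
Proof.
move=> c d /eqP; rewrite -subr_eq0 -jetB => /eqP/jet_eq0 cd.
by apply/funext => i; apply/eqP; rewrite -subr_eq0 cd.
Qed.

Definition const_coef m (a : R) (i : idx m) : R := if val i == 0 then a else 0.

Lemma jetC_jet m a : jetC R m a = jet (@const_coef m a).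
Proof. by rewrite (@jet_const _ _ _ a) // => -[[]]. Qed.

(** The jets of coefficient sequences form a subring that contains the
    constants and [t]. *)
Lemma jet_surj m (z : jet_ring R m) : exists c, jet c = z.
Proof.
case: m z => [n|] z; last by exists (fun i => pscoef z (val i)); apply/powserP.
have [p ->] := qproj_surj z; elim/mvpoly_ind: p => [a|[]|p q [c cE] [d dE]|].
- by exists (const_coef a); rewrite -jetC_jet.
- exists (fun i => (val i == 1)%:R) => /=.
  (* For n = 0 the variable is itself a generator of the ideal, so it is 0. *)
  case: n z => [|n] _.
    rewrite big_ord1 /= raddf0 mul0r; apply/qproj_eq.
    rewrite -opprB subr0; apply/ideal_ofP; rewrite rpredN.
    by apply: ideal_of_gen.
  rewrite !big_ord_recl big1 ?addr0 => [|i _]; last by rewrite raddf0 mul0r.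
  by rewrite raddf0 mul0r add0r rmorph1 mul1r.
- by exists (fun i => c i - d i); rewrite jetB cE dE raddfB.
move=> p q [c cE] [d dE].
exists (fun k => \sum_(i < (val k).+1) c (idx_lo i) * d (idx_hi i)).
by rewrite jetM cE dE rmorphM.
Qed.

End JetBijection.

(** * The three bijections *)

Section Bijections.
Variables (A B R : comPzRingType).
Variables (f : {rmorphism A -> B}) (g : {rmorphism A -> R}) (m : option nat).

Lemma higher_der_ext (D E : higher_der f g m) :
  (forall i x, sval D i x = sval E i x) -> D = E.
Proof.
case: D E => [D hD] [E hE] /= DE; apply: eq_exist.
by apply/funext => i; apply/funext => x.
Qed.

(** The classes of the constants and of the variables, which generate, are all
    values of some [d_i]. *)
Lemma hs_to_der_inj : injective (@hs_to_der A B R f g m).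
Proof.
move=> phi psi /(congr1 sval) /= e.
have {}e i x : phi (hs_d f i x) = psi (hs_d f i x).
  by move: (congr1 (fun D => D i x) e).
apply: algHom_ext => z; have [p ->] := qproj_surj z.
elim/mvpoly_ind: p => [x|[x i]|p q pE qE|p q pE qE].
- by rewrite -hs_var0; apply: e.
- by move: (e (val i) x); rewrite /hs_d /hs_var valK.
- by rewrite !rmorphB pE qE.
- by rewrite !rmorphM pE qE.
Qed.

(** Evaluate each constant by [D_0] and each variable [x^(i)] by [D_i x]: each
    family of generators goes to zero by one axiom of higher derivations. *)
Lemma hs_to_der_surj (D : higher_der f g m) : exists phi, hs_to_der phi = D.
Proof.
have DB i := hderB D i.
have [[h Dh] _ Dc DM] := svalP D.
have [ev [evC evX]] :=
  mvpoly_lift h (fun y : hs_vars B m => sval D (val y.2) y.1).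
have evE i x : ev (hs_var i x) = sval D i x.
  rewrite /hs_var; case: insubP => [j _ <-|]; first exact: evX.
  rewrite -eqn0Ngt => /eqP i0; rewrite [LHS]evC -Dh.
  by congr (sval D _ _); apply: val_inj.
have [p|Phi PhiE] := @quot_lift _ _ (@hs_rel A B f m) ev.
  case=> [x y i _|a i i0|x y k].
  - by rewrite !rmorphB !evE -{2}[x](addrK y) DB subKr subrr.
  - by rewrite evE Dc.
  - rewrite rmorphB rmorph_sum evE DM; apply/eqP; rewrite subr_eq0; apply/eqP.
    by apply: eq_bigr => i _; rewrite rmorphM !evE.
have PhiA a : Phi (hs_alg f m a) = g a.
  by rewrite hs_algE PhiE evE Dh ahomE.
exists (AlgHom PhiA); apply: higher_der_ext => i x /=.
by rewrite PhiE evE.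
Qed.

Lemma der_to_jet_inj : injective (@der_to_jet A B R f g m).
Proof.
move=> D E DE; apply: higher_der_ext => i x.
have := congr1 (fun h : algHom _ _ => h x) DE.
by move/jet_inj => /(congr1 (fun c => c i)).
Qed.

(** Take for [D_i x] the coefficient of order [i] of [H x]; the axioms hold
    because the coefficients of a difference, of a product and of a constant
    are known. *)
Lemma der_to_jet_surj (H : algHom f (jet_alg g m)) :
  exists D, der_to_jet D = H.
Proof.
have [coef coefK] := choice (@jet_surj R m).
have jetK c : coef (jet c) = c by apply: jet_inj.
have coefB z w i : coef (z - w) i = coef z i - coef w i.
  by rewrite -{1}[z]coefK -{1}[w]coefK -jetB jetK.
have coefM z w k : coef (z * w) k =
    \sum_(i < (val k).+1) coef z (idx_lo i) * coef w (idx_hi i).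
  by rewrite -{1}[z]coefK -{1}[w]coefK -jetM jetK.
have coefC r i : coef (jetC R m r) i = const_coef r i.
  by rewrite jetC_jet jetK.
have [||a|h hE] := @algHom_of_fun _ _ _ f g (fun x => coef (H x) (idx0 m)).
- by move=> x y; rewrite raddfB coefB.
- split=> [|x y]; first by rewrite rmorph1 -(rmorph1 (jetC R m)) coefC.
  rewrite rmorphM coefM big_ord1.
  by congr (coef _ _ * coef _ _); apply: val_inj.
- by rewrite ahomE coefC.
have HD : is_higher_der f g (fun (i : idx m) x => coef (H x) i).
  split=> [|i _ x y|i i0 a|k x y].
  - by exists h => x; rewrite hE.
  - by rewrite raddfB coefB.
  - by rewrite ahomE coefC /const_coef gtn_eqF.
  - by rewrite rmorphM coefM.
exists (exist _ _ HD); apply: algHom_ext => x.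
exact: coefK.
Qed.

End Bijections.

(** * Functoriality in the target and in the source *)

(** The formula prescribes the map on all elements since each is a jet; it is a
    homomorphism because termwise differences and convolutions commute with
    [u]. *)
Lemma jet_map (A R R' : comPzRingType) (g : {rmorphism A -> R})
    (g' : {rmorphism A -> R'}) (m : option nat) (u : algHom g g') :
  exists U : algHom (jet_alg g m) (jet_alg g' m),
    forall c : idx m -> R, U (jet c) = jet (fun i => u (c i)).
Proof.
have [coef coefK] := choice (@jet_surj R m).
have jetK c : coef (jet c) = c by apply: jet_inj.
pose F z := jet (fun i => u (coef z i)).
have FE c : F (jet c) = jet (fun i => u (c i)) by rewrite /F jetK.
have FC r : F (jetC R m r) = jetC R' m (u r).
  rewrite !jetC_jet FE; congr jet; apply/funext => i.
  by rewrite /const_coef; case: ifP; rewrite ?raddf0.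
have [||a|U UE] := @algHom_of_fun _ _ _ (jet_alg g m) (jet_alg g' m) F.
- move=> z w; rewrite -[z]coefK -[w]coefK -jetB !FE -jetB.
  by congr jet; apply/funext => i; rewrite raddfB.
- split=> [|z w]; first by rewrite -(rmorph1 (jetC R m)) FC !rmorph1.
  rewrite -[z]coefK -[w]coefK -jetM !FE -jetM.
  congr jet; apply/funext => k; rewrite rmorph_sum.
  by apply: eq_bigr => i _; rewrite rmorphM.
- by rewrite FC ahomE.
by exists U => c; rewrite UE FE.
Qed.

(** The universal derivation of [B] corresponds to the identity of its
    Hasse-Schmidt algebra; precomposed with [h] it is a higher derivation on
    [B'], which the universal property for [B'] turns into the map sought. *)
Lemma hs_map (A B B' : comPzRingType) (f : {rmorphism A -> B})
    (f' : {rmorphism A -> B'}) (m : option nat) (h : algHom f' f) :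
  exists F : algHom (hs_alg f' m) (hs_alg f m),
    forall (i : idx m) (x : B'), F (hs_d f' i x) = hs_d f i (h x).
Proof.
pose ident : algHom (hs_alg f m) (hs_alg f m) :=
  @AlgHom _ _ _ (hs_alg f m) (hs_alg f m) idfun (fun=> erefl).
have [[d0 d0E] dB dC dM] := svalP (hs_to_der ident).
have hD : is_higher_der f' (hs_alg f m) (fun (i : idx m) x => hs_d f i (h x)).
  split=> [|i i0 x y|i i0 a|k x y].
  - by exists (ahom_comp d0 h) => x; apply: d0E.
  - by rewrite raddfB; apply: dB.
  - by rewrite ahomE; apply: dC.
  - by rewrite rmorphM; apply: dM.
have [F FE] := hs_to_der_surj (exist _ _ hD).
by exists F => i x; have := congr1 (fun D => sval D i x) FE.
Qed.

Theorem corollary1p8 (A B R : comPzRingType)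
    (f : {rmorphism A -> B}) (g : {rmorphism A -> R}) (m : option nat) :
  (* the bijection, and its formula *)
  bijective (@hs_to_jet A B R f g m) /\
  (forall (phi : algHom (hs_alg f m) g) (x : B),
     hs_to_jet phi x = jet (fun i => phi (hs_d f i x))) /\
  (* it is the composite of the two bijections through Der *)
  bijective (@hs_to_der A B R f g m) /\
  (forall (phi : algHom (hs_alg f m) g) (i : idx m) (x : B),
     sval (hs_to_der phi) i x = phi (hs_d f i x)) /\
  bijective (@der_to_jet A B R f g m) /\
  (forall (D : higher_der f g m) (x : B),
     der_to_jet D x = jet (fun i => sval D i x)) /\
  (forall phi : algHom (hs_alg f m) g,
     hs_to_jet phi = der_to_jet (hs_to_der phi)) /\
  (* naturality in R *)
  (forall (R' : comPzRingType) (g' : {rmorphism A -> R'}) (u : algHom g g'),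
     exists U : algHom (jet_alg g m) (jet_alg g' m),
       (forall c : idx m -> R, U (jet c) = jet (fun i => u (c i))) /\
       (forall phi : algHom (hs_alg f m) g,
          hs_to_jet (ahom_comp u phi) = ahom_comp U (hs_to_jet phi))) /\
  (* naturality in B *)
  (forall (B' : comPzRingType) (f' : {rmorphism A -> B'}) (h : algHom f' f),
     exists F : algHom (hs_alg f' m) (hs_alg f m),
       (forall (i : idx m) (x : B'), F (hs_d f' i x) = hs_d f i (h x)) /\
       (forall phi : algHom (hs_alg f m) g,
          hs_to_jet (ahom_comp phi F) = ahom_comp (hs_to_jet phi) h)).
Proof.
have hsE (phi : algHom (hs_alg f m) g) :
    hs_to_jet phi = der_to_jet (hs_to_der phi) by apply: algHom_ext.
have bij_der : bijective (@hs_to_der A B R f g m).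
  exact: inj_surj_bij (@hs_to_der_inj _ _ _ f g m) (@hs_to_der_surj _ _ _ f g m).
have bij_jet : bijective (@der_to_jet A B R f g m).
  exact: inj_surj_bij (@der_to_jet_inj _ _ _ f g m) (@der_to_jet_surj _ _ _ f g m).
split; first exact: (eq_bij (bij_comp bij_jet bij_der) (fun phi => esym (hsE phi))).
do 6!split=> //; split=> [R' g' u|B' f' h].
- have [U UE] := jet_map m u; exists U; split=> // phi.
  by apply: algHom_ext => x; rewrite /= UE.
- have [F FE] := hs_map m h; exists F; split=> // phi.
  apply: algHom_ext => x; congr jet; apply/funext => i.
  exact: (congr1 phi (FE i x)).
Qed.
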